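(* Let $(\underline\alpha,\overline\alpha)\subseteq\mathbb R$ be a finite or infinite interval, let $\mathfrak D\subset\mathbb C$ be a stability region such that $\alpha\lambda\in\mathfrak D$ for every $\lambda\in\mathfrak D$ and every $\alpha\in(\underline\alpha,\overline\alpha)$, let $\mathcal G\subset\mathcal M^{n\times n}$ be an arbitrary matrix class and let $\circ$ be a binary operation on $\mathcal M^{n\times n}$. Suppose that one of the following holds: (1) $\alpha(\mathbf A\circ\mathbf B)=(\alpha\mathbf A)\circ\mathbf B=\mathbf A\circ(\alpha\mathbf B)$ for every $\alpha\in\mathbb R$ and all $\mathbf A,\mathbf B\in\mathcal M^{n\times n}$; (2) $\alpha(\mathbf A\circ\mathbf B)=(\alpha\mathbf A)\circ(\alpha\mathbf B)$ for every $\alpha\in\mathbb R$ and all $\mathbf A,\mathbf B\in\mathcal M^{n\times n}$, and $0\notin(\underline\alpha,\overline\alpha)$ and $\frac1\alpha\mathbf G\in\mathcal G$ for every $\mathbf G\in\mathcal G$ and every $\alpha\in(\underline\alpha,\overline\alpha)$. Then, if $\mathbf A\in\mathcal M^{n\times n}$ is $(\mathfrak D,\mathcal G,\circ)$-stable, the matrix $\alpha\mathbf A$ is $(\mathfrak D,\mathcal G,\circ)$-stable for every $\alpha\in(\underline\alpha,\overline\alpha)$.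
   Context: $\mathcal M^{n\times n}$ denotes the set of real $n\times n$ matrices and $\sigma(\mathbf A)\subset\mathbb C$ the spectrum (set of complex eigenvalues) of $\mathbf A$. A stability region is a set $\mathfrak D\subseteq\mathbb C$ such that $\lambda\in\mathfrak D$ implies $\overline\lambda\in\mathfrak D$. A matrix class is a subset of $\mathcal M^{n\times n}$. A matrix $\mathbf A\in\mathcal M^{n\times n}$ is called $(\mathfrak D,\mathcal G,\circ)$-stable if $\sigma(\mathbf G\circ\mathbf A)\subset\mathfrak D$ for every $\mathbf G\in\mathcal G$. *)

(* Defs.v *)
From mathcomp Require Import all_boot all_order all_algebra.
From mathcomp Require Import classical_sets reals constructive_ereal.
From mathcomp Require Export complex.

Set Implicit Arguments.
Unset Strict Implicit.
Unset Printing Implicit Defensive.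

Import Order.TTheory GRing.Theory Num.Theory.
Local Open Scope classical_set_scope.
Local Open Scope complex_scope.
Local Open Scope ring_scope.

(* [eigenvalue] is library-defined with row eigenvectors, v *m A = a *: v;
   for a square matrix over a field the eigenvalues are the same as with
   column eigenvectors. *)
Definition spectrum (R : realType) (n : nat) (A : 'M[R]_n) : set R[i] :=
  [set z | eigenvalue (map_mx (real_complex R) A) z].

Definition stability_region (R : realType) (D : set R[i]) : Prop :=
  forall z, D z -> D (conjc z).

Definition DG_stable (R : realType) (n : nat) (D : set R[i])
    (G : set 'M[R]_n) (op : 'M[R]_n -> 'M[R]_n -> 'M[R]_n) (A : 'M[R]_n) :
    Prop :=
  forall M, G M -> spectrum (op M A) `<=` D.

(* Main.v *)
(* By homogeneity, G o (x A) equals x (G' o A) for some G' in the class: G' = G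
   in case (1) and G' = x^-1 G in case (2).  Every eigenvalue of x B is x times
   an eigenvalue of B; when x = 0 this needs the spectrum of B to be nonempty,
   so algebraic closedness is used to put 0 in D. *)
Require Import Defs.
From mathcomp Require Import all_boot all_order all_algebra.
From mathcomp Require Import classical_sets reals constructive_ereal complex.

Import Order.TTheory GRing.Theory Num.Theory.
Local Open Scope classical_set_scope.
Local Open Scope complex_scope.
Local Open Scope ring_scope.

Section ScaledSpectrum.
Variables (R : realType) (n : nat).

(** The characteristic polynomial has degree [n > 0], so it has a root over the algebraically closed
    field [R[i]]. *)
Lemma spectrum_nonempty (B : 'M[R]_n) : (0 < n)%N -> exists z, spectrum B z.
Proof.
move=> n_gt0; set C := map_mx (real_complex R) B.
have sz : size (char_poly C) != 1%N by rewrite size_char_poly eqSS -lt0n.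
have [z rz] := closed_rootP _ sz.
by exists z; rewrite /spectrum /= eigenvalue_root_char.
Qed.

Lemma spectrumZ (x : R) (B : 'M[R]_n) (z : R[i]) :
  spectrum (x *: B) z -> exists2 w, spectrum B w & z = x%:C * w.
Proof.
rewrite /spectrum /= => /eigenvalueP [v]; rewrite map_mxZ /= -scalemxAr => vB v0.
have [x0|x_neq0] := eqVneq x 0.
  (* A nonzero row vector has a nonzero entry, whose index witnesses [0 < n]. *)
  have n_gt0 : (0 < n)%N.
    by have [j _] := rV0Pn _ v0; apply: leq_ltn_trans (ltn_ord j).
  have [w Bw] := spectrum_nonempty B n_gt0.
  (* For [x = 0] the eigenvector equation reads [0 = z *: v], so [z = 0] and any [w] in the spectrum
     serves. *)
  exists w => //; move: vB; rewrite x0 rmorph0 scale0r mul0r => /esym/eqP.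
  by rewrite scaler_eq0 (negbTE v0) orbF => /eqP.
have xC_neq0 : x%:C != 0 by rewrite fmorph_eq0.
(* The same eigenvector [v] works for [B] after dividing by [x]. *)
exists (x%:C^-1 * z); last by rewrite mulVKf.
apply/eigenvalueP; exists v => //.
by rewrite -scalerA -vB scalerK.
Qed.

End ScaledSpectrum.

Theorem theorem11 (R : realType) (n : nat) (a b : \bar R) (D : set R[i])
    (G : set 'M[R]_n) (op : 'M[R]_n -> 'M[R]_n -> 'M[R]_n)
    (HD : stability_region D)
    (HDab : forall (z : R[i]) (x : R),
      D z -> x%:E \in `]a, b[ -> D (x%:C * z))
    (Hop :
      (forall (x : R) (A B : 'M[R]_n),
         x *: op A B = op (x *: A) B /\ op (x *: A) B = op A (x *: B))
      \/
      [/\ (forall (x : R) (A B : 'M[R]_n),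
             x *: op A B = op (x *: A) (x *: B)),
          (0 : R)%:E \notin `]a, b[
        & (forall (M : 'M[R]_n) (x : R),
             G M -> x%:E \in `]a, b[ -> G (x^-1 *: M))])
    (A : 'M[R]_n) :
  DG_stable D G op A ->
  forall x : R, x%:E \in `]a, b[ -> DG_stable D G op (x *: A).
Proof.
move=> stA x abx M GM z.
suff [N GN ->] : exists2 N, G N & op M (x *: A) = x *: op N A.
  by case/spectrumZ=> w NAw ->; apply: HDab abx; apply: stA NAw.
case: Hop => [opZ|[opZ ab0 GV]].
  by exists M => //; have [-> ->] := opZ x M A.
have x_neq0 : x != 0 by apply: contraNneq ab0 => <-.
exists (x^-1 *: M); first exact: GV.
(* Joint homogeneity scales both arguments, and the factor [x] cancels the [x^-1] on [M]. *)
by rewrite opZ scalerA divff // scale1r.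
Qed.
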